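(* Let $\Gamma$ be an arbitrary uncountable set, and let $1<p\neq r<\infty$ (that is, $p,r\in(1,\infty)$ with $p\neq r$). Then for any $w_i:\Gamma\to(0,\infty)$, $i=1,2$, the space $\ell^{p,\infty}(\Gamma,w_1)$ is not isomorphic to $\ell^{r,\infty}(\Gamma,w_2)$.
   Context: For $1<p<\infty$, a set $\Gamma$ and $w:\Gamma\to(0,\infty)$, $\ell^{p,\infty}(\Gamma,w)$ is the space of all $x:\Gamma\to\mathbb{R}$ with $\|x\|=\sup_{c>0}c\,(\mu\{|x|>c\})^{1/p}<\infty$, where $\mu(A)=\sum_{\gamma\in A}w(\gamma)$ for $A\subseteq\Gamma$. This expression is equivalent to a norm under which the space is a Banach space. ''Isomorphic'' means linearly homeomorphic. *)

(* Defs.v *)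
From HB Require Import structures.
From mathcomp Require Import all_boot all_order all_algebra ring.
From mathcomp Require Import all_classical all_reals all_analysis.
Set Implicit Arguments.
Unset Strict Implicit.
Unset Printing Implicit Defensive.
Import Order.TTheory GRing.Theory Num.Theory.
Local Open Scope classical_set_scope.
Local Open Scope ring_scope.

Section isomorphic.
Context {K : numDomainType}.

Definition isomorphic (E F : preTopologicalLmodType K) : Prop :=
  exists (f : {linear E -> F}) (g : F -> E),
    [/\ cancel f g, cancel g f, continuous f & continuous g].

End isomorphic.

Section quasinorm.
Context {R : realType} {Gamma : choiceType}.
Implicit Types (w : Gamma -> {posnum R}) (p : R) (x y : Gamma -> R).
Local Open Scope ereal_scope.

Definition wmu w (A : set Gamma) : \bar R := \esum_(g in A) ((w g)%:num)%:E.

Definition wnorm w p x : \bar R :=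
  ereal_sup [set c%:E * (wmu w [set g | (c < `|x g|)%R]) `^ p^-1
            | c in [set c : R | (0 < c)%R]].

Lemma wmu_ge0 w A : 0 <= wmu w A.
Proof. by apply: esum_ge0 => g _; rewrite lee_fin. Qed.

Lemma le_wmu w A B : A `<=` B -> wmu w A <= wmu w B.
Proof.
move=> AB; apply: ge_ereal_sup => _ [F [finF FA] <-].
apply: ereal_sup_ubound; exists F => //.
by split => //; exact: subset_trans AB.
Qed.

Lemma wmuU w A B : wmu w (A `|` B) <= wmu w A + wmu w B.
Proof.
have w0 g : 0 <= (w g)%:num%:E :> \bar R by rewrite lee_fin.
rewrite [leLHS](esumID A)//; apply: leeD; apply: le_wmu.
  by move=> g [].
by move=> g [[]].
Qed.

Lemma wnorm_ge0 w p x : 0 <= wnorm w p x.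
Proof.
apply: (@le_trans _ _ (1%:E * (wmu w [set g | (1 < `|x g|)%R]) `^ p^-1)).
  by rewrite mul1e poweR_ge0.
by apply: ereal_sup_ubound; exists 1%R => //=; exact: ltr01.
Qed.

Lemma wnormP w p x (M : \bar R) :
  wnorm w p x <= M <->
  (forall c, (0 < c)%R -> c%:E * (wmu w [set g | (c < `|x g|)%R]) `^ p^-1 <= M).
Proof.
split=> [xM c c0|xM].
  by apply: le_trans xM; apply: ereal_sup_ubound; exists c.
by apply: ge_ereal_sup => _ [c /= c0 <-]; exact: xM.
Qed.

Lemma wnorm0 w p : (0 < p)%R -> wnorm w p 0%R = 0.
Proof.
move=> p0; apply/eqP; rewrite eq_le wnorm_ge0 andbT; apply/wnormP => c c0.
rewrite [X in wmu w X](_ : _ = set0); last first.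
  by apply/seteqP; split => g //=; rewrite normr0 ltNge ltW.
by rewrite /wmu esum_set0 poweR0r ?mule0// invr_neq0// gt_eqF.
Qed.

Lemma wnormZ_le w p a x : a != 0%R ->
  wnorm w p (a *: x)%R <= `|a|%:E * wnorm w p x.
Proof.
move=> a0; have na : (0 < `|a|)%R by rewrite normr_gt0.
apply/wnormP => c c0.
have -> : [set g | (c < `|(a *: x)%R g|)%R] = [set g | (c / `|a| < `|x g|)%R].
  by apply/seteqP; split => g /=; rewrite /GRing.scale/= normrM ltr_pdivrMr// mulrC.
have -> : c%:E = `|a|%:E * (c / `|a|)%:E :> \bar R.
  by rewrite -EFinM mulrCA divff ?mulr1// gt_eqF.
rewrite -muleA; rewrite lee_pmul2l ?lte_fin//.
by apply: ereal_sup_ubound; exists (c / `|a|)%R => //=; rewrite divr_gt0.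
Qed.

Lemma wnormD_le w p x y : (1 < p)%R ->
  wnorm w p (x + y)%R <= 4%:E * maxe (wnorm w p x) (wnorm w p y).
Proof.
move=> p1; have p0 : (0 < p)%R by exact: lt_trans p1.
have ip0 : (0 < p^-1)%R by rewrite invr_gt0.
set M := maxe _ _; apply/wnormP => c c0.
have c20 : (0 < c / 2)%R by rewrite divr_gt0.
set A := [set g | (c / 2 < `|x g|)%R]; set B := [set g | (c / 2 < `|y g|)%R].
have AB : [set g | (c < `|(x + y)%R g|)%R] `<=` A `|` B.
  move=> g /=; rewrite /A /B /= => cxy.
  case: (ltP (c / 2) `|x g|)%R => [|xc]; first by left.
  right; rewrite ltNge; apply/negP => yc.
  move: cxy; rewrite ltNge => /negP; apply.
  by rewrite (le_trans (ler_normD _ _))// (splitr c) lerD.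
have mAB : wmu w [set g | (c < `|(x + y)%R g|)%R] <=
    2%:E * maxe (wmu w A) (wmu w B).
  apply: (le_trans (le_wmu _ AB)); apply: (le_trans (wmuU _ _ _)).
  by rewrite -[2%:E]/((1 + 1)%R%:E) EFinD ge0_muleDl// mul1e leeD// le_max lexx ?orbT.
have m0 : 0 <= maxe (wmu w A) (wmu w B) by rewrite le_max wmu_ge0.
have pow : (wmu w [set g | (c < `|(x + y)%R g|)%R]) `^ p^-1 <=
    2%:E * (maxe (wmu w A) (wmu w B)) `^ p^-1.
  apply: (@le_trans _ _ ((2%:E * maxe (wmu w A) (wmu w B)) `^ p^-1)).
    apply: gt0_ler_poweR => //; first exact: ltW.
    - by rewrite in_itv/= wmu_ge0 leey.
    - by rewrite in_itv/= mule_ge0// leey.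
  rewrite poweRM//; apply: lee_wpmul2r; first exact: poweR_ge0.
  rewrite poweR_EFin lee_fin -[leRHS]powRr1//.
  by rewrite ler_powR ?ler1n// invf_le1// ltW.
have cE : c%:E * 2%:E = 4%:E * (c / 2)%:E :> \bar R.
  by rewrite -!EFinM; congr EFin; field.
apply: (@le_trans _ _ (c%:E * (2%:E * (maxe (wmu w A) (wmu w B)) `^ p^-1))).
  by apply: lee_wpmul2l => //; rewrite lee_fin ltW.
rewrite muleA cE -muleA; apply: lee_wpmul2l => //.
rewrite /M le_max; case: (leP (wmu w A) (wmu w B)) => _; apply/orP.
  by right; apply: ereal_sup_ubound; exists (c / 2)%R.
by left; apply: ereal_sup_ubound; exists (c / 2)%R.
Qed.

End quasinorm.

Section weak_lp.
Context {R : realType} {Gamma : choiceType}.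
Variables (w : Gamma -> {posnum R}) (p : R) (p1 : 1 < p).

(* The proof that 1 < p plays no role in the carrier; it is a parameter so that
   the vector space structure and the topology can be inferred. *)
Definition weak_lp_pred of 1 < p : {pred (Gamma -> R)} :=
  [pred x | (wnorm w p x < +oo)%E].

Record weak_lp := WeakLp {
  weak_lp_val :> Gamma -> R;
  _ : weak_lp_val \in weak_lp_pred p1 }.

Lemma weak_lp_submod_closed : submod_closed (weak_lp_pred p1).
Proof.
have p0 : 0 < p by exact: lt_trans p1.
split=> [|a x y]; rewrite !inE; first by rewrite wnorm0.
move=> xoo yoo; apply: (le_lt_trans (wnormD_le _ _ _ p1)).
rewrite lte_mul_pinfty// gt_max yoo andbT.
have [->|a0] := eqVneq a 0; first by rewrite scale0r wnorm0.
by apply: (le_lt_trans (wnormZ_le _ _ _ a0)); rewrite lte_mul_pinfty.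
Qed.

HB.instance Definition _ :=
  GRing.isSubmodClosed.Build _ _ (weak_lp_pred p1) weak_lp_submod_closed.

HB.instance Definition _ := [isSub for weak_lp_val].
HB.instance Definition _ := [Choice of weak_lp by <:].
HB.instance Definition _ := [SubChoice_isSubLmodule of weak_lp by <:].

Definition weak_lp_ball (x : weak_lp) (e : R) : set weak_lp :=
  [set y | (wnorm w p (y - x)%R < e%:E)%E].

(* [wnorm] is only a quasinorm: its balls need not be open, but they form a
   neighbourhood basis of the topology of any norm equivalent to [wnorm]. *)
Definition weak_lp_nbhs (x : weak_lp) : set_system weak_lp :=
  filter_from [set e : R | 0 < e] (weak_lp_ball x).

HB.instance Definition _ := hasNbhs.Build weak_lp weak_lp_nbhs.

Lemma weak_lp_ball_center x e : 0 < e -> weak_lp_ball x e x.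
Proof.
by move=> e0; rewrite /weak_lp_ball/= subrr wnorm0 ?lte_fin// (lt_trans _ p1).
Qed.

Lemma weak_lp_ball_trans x y z e :
  weak_lp_ball x (e / 4) y -> weak_lp_ball y (e / 4) z -> weak_lp_ball x e z.
Proof.
rewrite /weak_lp_ball/= => xy yz.
rewrite -(subrK y z) -addrA.
apply: (le_lt_trans (wnormD_le _ _ _ p1)).
have -> : e%:E = (4%:E * (e / 4)%:E)%E by rewrite -EFinM mulrCA divff ?mulr1.
by rewrite lte_pmul2l// gt_max yz xy.
Qed.

Lemma weak_lp_nbhs_filter (x : weak_lp) : ProperFilter (nbhs x).
Proof.
apply: filter_from_proper; last first.
  by move=> e /= e0; exists x; exact: weak_lp_ball_center.
apply: filter_from_filter; first by exists 1; rewrite /= ltr01.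
move=> d e /= d0 e0; exists (Num.min d e); first by rewrite /= lt_min d0.
by move=> y; rewrite /weak_lp_ball/= EFin_min lt_min => /andP[].
Qed.

Lemma weak_lp_nbhs_singleton (x : weak_lp) A : nbhs x A -> A x.
Proof. by move=> [e e0]; apply; exact: weak_lp_ball_center. Qed.

Lemma weak_lp_nbhs_nbhs (x : weak_lp) A : nbhs x A -> nbhs x (nbhs^~ A).
Proof.
move=> [e /= e0 eA]; exists (e / 4); first by rewrite /= divr_gt0.
move=> y xy; exists (e / 4); first by rewrite /= divr_gt0.
by move=> z yz; apply: eA; exact: weak_lp_ball_trans yz.
Qed.

HB.instance Definition _ := Nbhs_isNbhsTopological.Build weak_lp
  weak_lp_nbhs_filter weak_lp_nbhs_singleton weak_lp_nbhs_nbhs.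

End weak_lp.

(* Main.v *)
Require Import Defs.
From HB Require Import structures.
From mathcomp Require Import all_boot all_order all_algebra.
From mathcomp Require Import all_classical all_reals all_analysis.
Import Order.TTheory GRing.Theory Num.Theory.
Local Open Scope classical_set_scope.
Local Open Scope ring_scope.

(** The idea is that an injective continuous linear map [T] from
[weak_lp w1 p1] to [weak_lp w2 r1] already forces [p <= r]; an isomorphism and
its inverse then give [p <= r] and [r <= p].

Let [e g] be the unit vectors. A sum of [N] vectors [+- e g], with weights
[w1 g] bounded, has quasinorm at most a constant times [N ^ (1/p)]
([wnorm_dominated_le]), and [T] can only multiply this by a constant. It
therefore suffices to find, for every [N], such a sum whose image exceeds a
fixed [c] at [N] coordinates of weight at least a fixed [m], since the image
then has quasinorm at least a constant times [N ^ (1/r)] ([wnorm_ge]), and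
[1/r <= 1/p] follows by letting [N] grow ([growth_exponent_le]).

By injectivity each [T (e g)] has a nonzero coordinate. As the index set is
uncountable, countably many cases reduce to an uncountable set [S] on which
[w1] is bounded and, for each [g] in [S], some coordinate of [T (e g)] exceeds
[c] and has weight at least [m]. On the other hand a fixed coordinate [b]
vanishes at [T (e g)] for all but countably many [g] in [S]
([countable_image_neq0]): if [|T (e g) b| >= c] for infinitely many [g], then
sums of [N] signed unit vectors would have images of size at least [c * N] at
[b], which is too much since [1/p < 1].

The sums are then built one vector at a time ([many_large_coordinates]): the
next [g] is chosen in [S] so that [T (e g)] vanishes at all coordinates [b]
selected so far, which leaves these coordinates unchanged, and the sign of
[e g] is chosen so that no cancellation occurs at the new coordinate. *)

(** * Quasinorm estimates *)

(** Otherwise [N ^ (a - b)] would be bounded by [C]. *)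
Lemma powR_nat_growth (R : realType) (a b C : R) :
  (forall N : nat, (0 < N)%N -> N%:R `^ a <= C * N%:R `^ b) -> a <= b.
Proof.
move=> H; rewrite leNgt; apply/negP => ba.
have d0 : 0 < a - b by rewrite subr_gt0.
pose C1 := `|C| + 1; have C10 : 0 < C1 by rewrite ltr_wpDl.
have [N CN] : exists N : nat, C1 `^ (a - b)^-1 < N%:R.
  by exists (Num.bound (C1 `^ (a - b)^-1)); rewrite archi_boundP// powR_ge0.
have N0 : 0 < N%:R :> R by apply: le_lt_trans CN; exact: powR_ge0.
have := H N; rewrite -(ltr_nat R) => /(_ N0).
rewrite -(subrK b a) powRD; last by rewrite (gt_eqF N0) implybT.
rewrite ler_pM2r ?powR_gt0// leNgt => /negP; apply.
apply: (@lt_trans _ _ C1); first by rewrite /C1 (le_lt_trans (ler_norm _))// ltrDl.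
have -> : C1 = (C1 `^ (a - b)^-1) `^ (a - b).
  by rewrite -powRrM mulVf ?gt_eqF// powRr1// ltW.
by rewrite gt0_ltr_powR ?nnegrE ?powR_ge0 ?ler0n.
Qed.

Section quasinorm_bounds.
Context {R : realType} {Gamma : choiceType}.
Implicit Types (w : Gamma -> {posnum R}) (p : R) (x : Gamma -> R).

(** The bound of [|x|] by the indicator of [s]. All that matters of a sum of
signed unit vectors is that it has this property. *)
Definition dominated (s : seq Gamma) x := forall g, `|x g| <= (g \in s)%:R.

Lemma wmu_seq w (s : seq Gamma) : uniq s ->
  wmu w [set` s] = (\sum_(g <- s) (w g)%:num)%:E.
Proof.
by move=> us; rewrite /wmu esum_fset -?fsbig_seq ?sumEFin// => g _; rewrite lee_fin.
Qed.

Lemma wnorm_dominated_le w p x (s : seq Gamma) (n : R) : 0 < p ->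
  uniq s -> (forall g, g \in s -> (w g)%:num <= n) -> dominated s x ->
  (wnorm w p x <= ((n * (size s)%:R) `^ p^-1)%:E)%E.
Proof.
move=> p0 us sn xs; apply/wnormP => c c0.
case: (leP 1 c) => [c1|c1].
  rewrite [X in wmu w X](_ : _ = set0).
    rewrite /wmu esum_set0 poweR0r ?mule0 ?lee_fin ?powR_ge0//.
    by rewrite invr_neq0// gt_eqF.
  (* at levels c >= 1 the set where |x| > c is empty *)
  apply/seteqP; split => g //=; rewrite ltNge => /negP; apply.
  by apply: le_trans (xs g) (le_trans _ c1); case: (g \in s).
have mus : (wmu w [set g | (c < `|x g|)%R] <= (n * (size s)%:R)%:E)%E.
  apply: (@le_trans _ _ (wmu w [set` s])).
    apply: le_wmu => g /= cg; apply/negPn/negP => gs.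
    by have := lt_trans c0 (lt_le_trans cg (xs g)); rewrite (negbTE gs) ltxx.
  rewrite wmu_seq// lee_fin mulr_natr -sum1_size -sumrMnr.
  rewrite [leLHS]big_seq [leRHS]big_seq; apply: ler_sum => g gs.
  by rewrite mulr1n sn.
rewrite -[leRHS]mul1e; apply: lee_pmul; rewrite ?lee_fin ?poweR_ge0 ?(ltW c0) ?(ltW c1)//.
rewrite -poweR_EFin; apply: gt0_ler_poweR => //.
- by rewrite invr_ge0 ltW.
- by rewrite in_itv/= wmu_ge0 leey.
- by rewrite in_itv/= (le_trans (wmu_ge0 _ _) mus) leey.
Qed.

Lemma wnorm_ge w p x (t : seq Gamma) (m c : R) : 0 < p -> 0 < c -> 0 <= m ->
  uniq t -> (forall b, b \in t -> m <= (w b)%:num /\ c < `|x b|) ->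
  ((c * (m * (size t)%:R) `^ p^-1)%:E <= wnorm w p x)%E.
Proof.
move=> p0 c0 m0 ut tm.
have mut : ((m * (size t)%:R)%:E <= wmu w [set b | (c < `|x b|)%R])%E.
  apply: (@le_trans _ _ (wmu w [set` t])).
    rewrite wmu_seq// lee_fin mulr_natr -sum1_size -sumrMnr.
    rewrite [leLHS]big_seq [leRHS]big_seq; apply: ler_sum => b bt.
    by rewrite mulr1n; case: (tm b bt).
  by apply: le_wmu => b /= /tm[].
apply: le_trans (ereal_sup_ubound _); last by exists c.
rewrite EFinM lee_pmul2l ?lte_fin// -poweR_EFin.
apply: gt0_ler_poweR => //.
- by rewrite invr_ge0 ltW.
- by rewrite in_itv/= lee_fin mulr_ge0 ?leey.
- by rewrite in_itv/= wmu_ge0 leey.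
Qed.

End quasinorm_bounds.

(** * Signed sums of unit vectors *)

Section unit_vector.
Context {R : realType} {Gamma : choiceType} (w : Gamma -> {posnum R}).
Context {p : R} (p1 : 1 < p).

Lemma unit_vector_subproof (g : Gamma) :
  (fun h => (h == g)%:R : R) \in weak_lp_pred w p1.
Proof.
have p0 := lt_trans ltr01 p1; rewrite inE.
apply: (le_lt_trans (@wnorm_dominated_le _ _ w p _ [:: g] (w g)%:num p0 _ _ _)).
- by [].
- by move=> h; rewrite inE => /eqP ->.
- by move=> h; rewrite inE; case: (h == g); rewrite ?normr1 ?normr0.
- exact: ltry.
Qed.

Definition unit_vector (g : Gamma) : weak_lp w p1 :=
  WeakLp (unit_vector_subproof g).

Lemma dominated_cons_unit_vector g s (x : weak_lp w p1) (a : R) :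
  `|a| <= 1 -> g \notin s -> dominated s x ->
  dominated (g :: s) (x + a *: unit_vector g).
Proof.
move=> a1 gs xs h.
have -> : (x + a *: unit_vector g) h = x h + a * (h == g)%:R by [].
rewrite inE; have [->|hg] := eqVneq h g => /=; last by rewrite mulr0 addr0 xs.
have := xs g; rewrite (negbTE gs) normr_le0 => /eqP ->.
by rewrite add0r mulr1.
Qed.

Lemma dominated0 (s : seq Gamma) : dominated s (0 : weak_lp w p1).
Proof. by move=> g; have -> : (0 : weak_lp w p1) g = 0 by []; rewrite normr0. Qed.

End unit_vector.

(** * Injective continuous linear maps *)

Section continuous_linear.
Context {R : realType} {Gamma : choiceType} (w1 w2 : Gamma -> {posnum R}).
Context {p r : R} (p1 : 1 < p) (r1 : 1 < r).
Variable T : {linear weak_lp w1 p1 -> weak_lp w2 r1}.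
Hypothesis Tc : continuous T.
Local Notation e := (unit_vector w1 p1).

Lemma continuous_linear_bounded : exists2 K : R, 0 < K &
  forall (x : weak_lp w1 p1) (M : R), 0 < M -> (wnorm w1 p x <= M%:E)%E ->
    (wnorm w2 r (T x) <= (K * M)%:E)%E.
Proof.
have B1 : nbhs (T 0) (weak_lp_ball (T 0) 1) by exists (1 : R) => //=; exact: ltr01.
have [d /= d0 dT] := Tc 0 _ B1.
exists (2 / d); first by rewrite divr_gt0.
move=> x M M0 xM; pose a := d / (2 * M).
have a0 : 0 < a by rewrite divr_gt0// mulr_gt0.
have : weak_lp_ball (T 0) 1 (T (a *: x)).
  apply: dT; rewrite /weak_lp_ball/= subr0.
  apply: (le_lt_trans (wnormZ_le _ _ _ _)); first by rewrite gt_eqF.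
  apply: (@le_lt_trans _ _ (`|a|%:E * M%:E)%E); first by rewrite lee_wpmul2l.
  rewrite gtr0_norm// -EFinM lte_fin /a invfM mulrA mulfVK ?gt_eqF//.
  by rewrite ltr_pdivrMr// ltr_pMr// ltr1n.
rewrite /weak_lp_ball/= linear0 subr0 => Ta.
have -> : T x = a^-1 *: T (a *: x) by rewrite linearZ/= scalerA mulVf ?scale1r// gt_eqF.
apply: (le_trans (wnormZ_le _ _ _ _)); first by rewrite invr_eq0 gt_eqF.
have -> : (2 / d * M)%:E = (`|a^-1|%:E * 1%:E)%E.
  rewrite gtr0_norm ?invr_gt0// mule1 /a invf_div; congr EFin.
  by rewrite mulrAC.
by rewrite lee_wpmul2l// ltW.
Qed.

(** The quasinorm of [x] is at most [(n * N) ^ (1/p)] and [T] is bounded, so the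
quasinorm of [T x] cannot grow faster than [N ^ (1/p)]. *)
Lemma growth_exponent_le (S : set Gamma) (n A a : R) :
  (forall g, S g -> (w1 g)%:num <= n) -> 0 < A ->
  (forall N : nat, (0 < N)%N -> exists (x : weak_lp w1 p1) (s : seq Gamma),
    [/\ uniq s /\ size s = N, [set` s] `<=` S, dominated s x &
        ((A * N%:R `^ a)%:E <= wnorm w2 r (T x))%E]) ->
  a <= p^-1.
Proof.
move=> Sn A0 H.
have p0 := lt_trans ltr01 p1.
have n0 : 0 < n.
  have [_ [[|g s] [[_ //= _] sS _ _]]] := H 1 isT.
  by apply: lt_le_trans (Sn g (sS g _)) => //=; rewrite mem_head.
have [K K0 KT] := continuous_linear_bounded.
apply: (@powR_nat_growth _ _ _ (K * n `^ p^-1 / A)) => N N0.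
have [x [s [[us sN] sS xs Tx]]] := H N N0.
have nN0 : 0 < (n * N%:R) `^ p^-1 by rewrite powR_gt0// mulr_gt0 ?ltr0n.
have xn : (wnorm w1 p x <= ((n * N%:R) `^ p^-1)%:E)%E.
  by rewrite -sN; apply: wnorm_dominated_le => // g /sS /Sn.
have := le_trans Tx (KT _ _ nN0 xn); rewrite lee_fin => KN.
by rewrite mulrAC ler_pdivlMr// mulrC -[leRHS]mulrA -powRM ?ler0n ?(ltW n0).
Qed.

Lemma image_perturb x g a b :
  (T (x + a *: e g) : Gamma -> R) b = T x b + a * T (e g) b.
Proof. by rewrite linearD linearZ. Qed.

(** The signs are those of [T (e g) b], so that the values at [b] add up. *)
Lemma signed_sum_large (s : seq Gamma) (b : Gamma) (c : R) : uniq s ->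
  (forall g, g \in s -> c <= `|T (e g) b|) ->
  exists2 x : weak_lp w1 p1, dominated s x & c * (size s)%:R <= T x b.
Proof.
elim: s => [_ _|g s IH /= /andP[gs us] sc].
  by exists 0; [exact: dominated0 | rewrite linear0 mulr0].
have [|x xs xb] := IH us; first by move=> h hs; apply: sc; rewrite inE hs orbT.
exists (x + Num.sg (T (e g) b) *: e g).
  apply: dominated_cons_unit_vector => //.
  by rewrite normr_sg; case: (_ != 0); rewrite ?normr1 ?normr0 ?ler01.
by rewrite image_perturb -normrEsg mulrSr mulrDr mulr1 lerD// sc// mem_head.
Qed.

(** With [N] such [g], a signed sum of the [e g] has an image of size at least
[c * N] at the single coordinate [b]: the exponent of growth [1] would be at
most [1/p]. *)
Lemma finite_image_large (S : set Gamma) (n c : R) (b : Gamma) : 0 < c ->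
  (forall g, S g -> (w1 g)%:num <= n) ->
  finite_set [set g | S g /\ c <= `|T (e g) b|].
Proof.
move=> c0 Sn; apply: contrapT => Sinf.
suff : 1 <= p^-1.
  by rewrite leNgt invf_lt1 ?p1// (lt_trans ltr01 p1).
have A0 : 0 < c / 2 * (w2 b)%:num `^ r^-1.
  by rewrite mulr_gt0 ?powR_gt0// divr_gt0.
apply: (growth_exponent_le _ _ _ _ Sn A0) => N N0.
have [F FS NF] := infinite_set_fset N Sinf.
pose s := take N (finmap.enum_fset F).
have us : uniq s by rewrite take_uniq// finmap.fset_uniq.
have sN : size s = N by rewrite size_take_min; exact/minn_idPl.
have ss g : g \in s -> S g /\ c <= `|T (e g) b| by move=> /mem_take /FS.
have [|x xs] := @signed_sum_large s b c us; first by move=> g /ss[].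
rewrite sN => xb; exists x, s; split => //; first by move=> g /ss[].
have NR0 : 0 < N%:R :> R by rewrite ltr0n.
have c20 : 0 < c / 2 * N%:R by rewrite mulr_gt0// divr_gt0.
rewrite powRr1 ?ler0n// mulrAC -[(w2 b)%:num](mulr1 (w2 b)%:num).
apply: (wnorm_ge w2 r _ [:: b]) => //; first exact: lt_trans r1.
move=> _ /[!inE] /eqP ->; split=> //.
(* the factor 1/2 in A makes this inequality strict *)
apply: lt_le_trans (le_trans xb (ler_norm _)).
by rewrite ltr_pM2r// ltr_pdivrMr// ltr_pMr// ltr1n.
Qed.

Lemma countable_image_neq0 (S : set Gamma) (n : R) (b : Gamma) :
  (forall g, S g -> (w1 g)%:num <= n) ->
  countable [set g | S g /\ T (e g) b != 0].
Proof.
move=> Sn; pose F (k : nat) := [set g | S g /\ k.+1%:R^-1 <= `|T (e g) b|].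
apply: (@sub_countable _ _ _ (\bigcup_k F k)); last first.
  apply: bigcup_countable => // k _; apply: finite_set_countable.
  by apply: (@finite_image_large _ n) => //; rewrite invr_gt0.
apply: subset_card_le => g /= [Sg Tg].
exists (Num.bound `|T (e g) b|^-1) => //; split=> //.
have T0 : 0 < `|T (e g) b| by rewrite normr_gt0.
rewrite -[leRHS]invrK lef_pV2 ?posrE ?invr_gt0//.
by rewrite ltW// (lt_trans (archi_boundP _)) ?ltr_nat// invr_ge0.
Qed.

(** The inductive construction of the sum: since [T (e g)] vanishes at the
coordinates in [t], adding a multiple of [e g] does not affect them. *)
Lemma many_large_coordinates (S : set Gamma) (n c m : R) :
  ~ countable S -> (forall g, S g -> (w1 g)%:num <= n) ->
  0 < c ->
  (forall g, S g -> exists b, m <= (w2 b)%:num /\ c < `|T (e g) b|) ->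
  forall N : nat, exists (x : weak_lp w1 p1) (s t : seq Gamma),
    [/\ uniq s /\ size s = N, [set` s] `<=` S, dominated s x,
        uniq t /\ size t = N &
        forall b, b \in t -> m <= (w2 b)%:num /\ c < `|T x b|].
Proof.
move=> Su Sn c0 Sb; elim=> [|N [x [s [t [[us sN] sS xs [ut tN] tx]]]]].
  by exists 0, [::], [::]; split=> //; exact: dominated0.
pose B := [set` s] `|` \bigcup_(b in [set` t]) [set g | S g /\ T (e g) b != 0].
have Bc : countable B.
  rewrite /B -bigcup2E; apply: bigcup_countable => // -[|[|k]] _ //=.
  - exact/finite_set_countable.
  - apply: bigcup_countable; first exact/finite_set_countable.
    by move=> b _; exact: countable_image_neq0 Sn.
have [g Sg Bg] : exists2 g, S g & ~ B g.
  apply: contrapT => H; apply: Su; apply: sub_countable Bc.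
  by apply: subset_card_le => g Sg; apply: contrapT => Bg; apply: H; exists g.
have gs : g \notin s by apply/negP => gs; apply: Bg; left.
have gt b : b \in t -> T (e g) b = 0.
  move=> bt; apply/eqP/negPn/negP => Tb; apply: Bg; right.
  by exists b.
have [b [mb cb]] := Sb g Sg.
have bt : b \notin t.
  by apply/negP => /gt Tb; move: cb; rewrite Tb normr0 ltNge ltW.
(* the coefficient a = 1 or -1 of e g that makes both terms have the same sign *)
have [a a1 ab] : exists2 a : R, `|a| <= 1 & c < `|T x b + a * T (e g) b|.
  case: (leP 0 (T x b * T (e g) b)) => [?|?].
  - exists 1; first by rewrite normr1.
    apply: lt_le_trans cb _; rewrite mul1r.
    rewrite -ler_sqr ?nnegrE// !real_normK ?num_real// sqrrD.
    by rewrite lerDr addr_ge0 ?sqr_ge0 ?mulrn_wge0.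
  - exists (-1); first by rewrite normrN1.
    apply: lt_le_trans cb _; rewrite mulN1r.
    rewrite -ler_sqr ?nnegrE// !real_normK ?num_real// sqrrB.
    by rewrite lerDr addr_ge0 ?sqr_ge0// oppr_ge0 mulrn_wle0// ltW.
exists (x + a *: e g), (g :: s), (b :: t); split => /=.
- by rewrite gs us sN.
- by move=> h /=; rewrite inE => /predU1P[->//|]; exact: sS.
- exact: dominated_cons_unit_vector.
- by rewrite bt ut tN.
- move=> b'; rewrite inE image_perturb => /predU1P[->//|b't].
  by rewrite gt// mulr0 addr0; exact: tx.
Qed.

(** One of countably many sets [F k] is uncountable; there a single constant
bounds [w1] from above, and its inverse bounds from below both a coordinate of
[T (e g)] and the weight of that coordinate. *)
Lemma injective_exponent_le : ~ countable [set: Gamma] -> injective T -> p <= r.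
Proof.
move=> Gu Tinj.
have p0 := lt_trans ltr01 p1; have r0 := lt_trans ltr01 r1.
pose F (k : nat) := [set g | (w1 g)%:num <= k.+1%:R /\
  exists b, k.+1%:R^-1 <= (w2 b)%:num /\ k.+1%:R^-1 < `|T (e g) b|].
have [k Fk] : exists k, ~ countable (F k).
  apply: contrapT => H; apply: Gu.
  apply: (@sub_countable _ _ _ (\bigcup_k F k)); last first.
    by apply: bigcup_countable => // k _; apply: contrapT => Fk; apply: H; exists k.
  apply: subset_card_le => g _.
  have [b Tb] : exists b, T (e g) b != 0.
    apply: contrapT => H1.
    have : T (e g) = T 0.
      rewrite linear0; apply: val_inj; apply/funext => b; apply: contrapT => Tb.
      by apply: H1; exists b; apply/eqP.
    move=> /Tinj /(congr1 (fun x : weak_lp w1 p1 => x g)).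
    by rewrite /= eqxx => /eqP; rewrite oner_eq0.
  have T0 : 0 < `|T (e g) b| by rewrite normr_gt0.
  (* an index exceeding each of the three summands *)
  pose y := (w1 g)%:num + (w2 b)%:num^-1 + `|T (e g) b|^-1.
  have y0 : 0 <= y by rewrite !addr_ge0 ?invr_ge0.
  have yk : y < (Num.bound y).+1%:R.
    by rewrite (lt_trans (archi_boundP y0))// ltr_nat.
  exists (Num.bound y) => //; split.
    by rewrite ltW// (le_lt_trans _ yk)// /y -addrA lerDl addr_ge0 ?invr_ge0.
  exists b; split.
    rewrite -[leRHS]invrK lef_pV2 ?posrE ?invr_gt0// ltW// (le_lt_trans _ yk)//.
    by rewrite /y addrAC lerDr addr_ge0 ?invr_ge0.
  rewrite -[ltRHS]invrK ltf_pV2 ?posrE ?invr_gt0// (le_lt_trans _ yk)//.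
  by rewrite /y lerDr addr_ge0 ?invr_ge0.
pose m : R := k.+1%:R^-1; have m0 : 0 < m by rewrite invr_gt0.
have Fn g : F k g -> (w1 g)%:num <= k.+1%:R by case.
have A0 : 0 < m * m `^ r^-1 by rewrite mulr_gt0 ?powR_gt0.
suff : r^-1 <= p^-1 by rewrite lef_pV2.
apply: (growth_exponent_le _ _ _ _ Fn A0) => N _.
have [|x [s [t [usN sS xs [ut tN] tx]]]] :=
  many_large_coordinates _ _ m m Fk Fn m0 _ N; first by move=> g [].
exists x, s; split => //.
rewrite -mulrA -powRM ?ler0n ?(ltW m0)// -tN.
by apply: wnorm_ge => //; exact: ltW.
Qed.

End continuous_linear.

(** * Non-isomorphism *)

Theorem theorem12 (R : realType) (Gamma : choiceType)
    (Gamma_uncountable : ~ countable [set: Gamma])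
    (p r : R) (p1 : 1 < p) (r1 : 1 < r) (pr : p <> r)
    (w1 w2 : Gamma -> {posnum R}) :
  ~ isomorphic (weak_lp w1 p1) (weak_lp w2 r1).
Proof.
move=> [f [g [fK gK fc gc]]]; apply: pr; apply/eqP; rewrite eq_le.
apply/andP; split.
  exact: (injective_exponent_le _ _ _ _ _ fc Gamma_uncountable (can_inj fK)).
pose gl := GRing.isLinear.Build _ _ _ _ g (can2_linear fK gK).
pose G : {linear weak_lp w2 r1 -> weak_lp w1 p1} := HB.pack g gl.
exact: (@injective_exponent_le _ _ w2 w1 r p r1 p1 G gc Gamma_uncountable (can_inj gK)).
Qed.
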